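(* Let $n\ge 1$ and let $M_A(n)$ be a Kasteleyn-Percus matrix for domino tilings of the Aztec diamond of order $n$. Then $$\operatorname{coker} M_A(n) \cong \mathbb{Z}/2 \oplus \mathbb{Z}/4 \oplus \cdots \oplus \mathbb{Z}/2^n .$$
   Context: The Aztec diamond of order $n$ is the polyomino consisting of those unit squares (with vertices in $\mathbb{Z}^2$) lying entirely inside the region $|x|+|y|\le n+1$ of the plane. Let $Z_A(n)$ be the planar graph dual to its tiling by unit squares: it has one vertex for each unit square of the Aztec diamond and one edge for each pair of squares of the diamond sharing a side, so that domino tilings of the diamond correspond to perfect matchings of $Z_A(n)$. It is bipartite (checkerboard coloring, black and white) and is embedded in the plane in the obvious way. A Kasteleyn-Percus matrix of a bipartite planar graph is obtained as follows. Assign a sign $+$ or $-$ to each edge so that each finite face has an odd number of $-$ signs on its boundary if and only if its number of sides is divisible by $4$. The matrix $M$ has rows indexed by the black vertices and columns indexed by the white vertices, and $M_{i,j}$ is the number of positive edges minus the number of negative edges joining black vertex $i$ and white vertex $j$. For an integer $p\times k$ matrix $M$, viewed as a homomorphism $\mathbb{Z}^k\to\mathbb{Z}^p$, $\operatorname{coker} M=\mathbb{Z}^p/\operatorname{im} M$. *)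

(* Defs.v *)
From HB Require Import structures.
From mathcomp Require Import all_boot all_order all_algebra.
From mathcomp Require Import boolp.

Set Implicit Arguments.
Unset Strict Implicit.
Unset Printing Implicit Defensive.

Import GRing.Theory Num.Theory.
Local Open Scope ring_scope.

(* The cell (a, b) is the unit square [a, a+1] x [b, b+1]; a polyomino is a
   predicate on cells. *)
Notation cell := (int * int)%type.

(* The region |x| + |y| <= n + 1 is convex, so that a unit square lies inside
   it iff its four corners do. *)
Definition aztec_diamond (n : nat) : {pred cell} :=
  [pred s : cell | all (fun p : cell => `|p.1| + `|p.2| <= n.+1%:Z)
                       [:: s; s + (1, 0); s + (0, 1); s + (1, 1)]].

Definition share_side (s t : cell) : bool :=
  `|s.1 - t.1| + `|s.2 - t.2| == 1.

(* The checkerboard coloring; c tells which of the two parity classes is the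
   black one. *)
Definition black (c : bool) : {pred cell} :=
  [pred s : cell | odd `|(s.1 + s.2)%R|%N == c].

Definition white (c : bool) : {pred cell} := [predC black c].

Section PlanarDual.

(* The dual graph of P has the cells of P as vertices, each drawn at the center
   of its square, and a straight edge for each pair of cells sharing a side. A
   dart is a pair (s, t) of adjacent cells, i.e., an edge traversed from s
   to t. *)
Variable P : {pred cell}.

Definition dart (d : cell * cell) : bool :=
  [&& d.1 \in P, d.2 \in P & share_side d.1 d.2].

Definition turn_left (e : cell) : cell := (- e.2, e.1).

(* The dart that follows d on the boundary of the face on the left of d: at the
   end of d take the leftmost available direction, turning back at a dead
   end. *)
Definition face_next (d : cell * cell) : cell * cell :=
  let e := d.2 - d.1 in
  (d.2, d.2 + head (- e) [seq e' <- [:: turn_left e; e; - turn_left e]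
                            | d.2 + e' \in P]).

(* Twice the signed area enclosed by a closed walk (shoelace formula). Moving
   the origin to the center of the cell (0, 0) does not change it. *)
Definition area2 (c : seq (cell * cell)) : int :=
  \sum_(d <- c) (d.1.1 * d.2.2 - d.2.1 * d.1.2).

(* c lists the darts of the boundary walk of a finite face. In a connected
   plane graph each face has a single boundary walk; with the face kept on the
   left, this walk encloses a positive area iff the face is finite. (The walk
   around the infinite face encloses minus the total area of the finite
   faces.) *)
Definition finite_face (c : seq (cell * cell)) : Prop :=
  [/\ all dart c, ucycle (frel face_next) c & 0 < area2 c].

(* neg s t means that the edge between s and t carries the sign -; its values
   on nonadjacent cells are irrelevant. *)
Definition kasteleyn_signs (neg : rel cell) : Prop :=
  symmetric neg /\
  forall c, finite_face c ->
    odd (count (fun d => neg d.1 d.2) c) = (4 %| size c)%N.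

(* The rows (columns) of M are indexed by the black (white) cells through the
   duplicate-free enumeration b (w). The entry is the number of positive edges
   minus the number of negative edges, the graph being simple. *)
Definition kasteleyn_percus p k (M : 'M[int]_(p, k)) : Prop :=
  exists (c : bool) (neg : rel cell) (b : p.-tuple cell) (w : k.-tuple cell),
    [/\ kasteleyn_signs neg,
        uniq b /\ b =i [predI P & black c],
        uniq w /\ w =i [predI P & white c]
      & forall i j, let s := tnth b i in let t := tnth w j in
          M i j = (share_side s t && ~~ neg s t)%:Z
                  - (share_side s t && neg s t)%:Z].

End PlanarDual.

Section Cokernel.

Variables (p k : nat) (M : 'M[int]_(p, k)).

Definition immx : {pred 'cV[int]_p} :=
  [pred v | `[< exists u : 'cV[int]_k, v = M *m u >]].

Fact immx_zmod_closed : zmod_closed immx.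
Proof.
split=> [|v v' /asboolP[u ->] /asboolP[u' ->]]; apply/asboolP.
  by exists 0; rewrite mulmx0.
by exists (u - u'); rewrite mulmxBr.
Qed.

HB.instance Definition _ :=
  GRing.isZmodClosed.Build 'cV[int]_p immx immx_zmod_closed.

Definition coker : zmodType := Quotient.quot immx.

End Cokernel.

Section DirectSum.

Variables (I : finType) (V : I -> zmodType).

Definition dirsum := {dffun forall i, V i}.

HB.instance Definition _ := Choice.on dirsum.

Definition dirsum_zero : dirsum := [ffun i => 0].
Definition dirsum_opp (f : dirsum) : dirsum := [ffun i => - f i].
Definition dirsum_add (f g : dirsum) : dirsum := [ffun i => f i + g i].

Fact dirsum_addA : associative dirsum_add.
Proof. by move=> f g h; apply/ffunP=> i; rewrite !ffunE addrA. Qed.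
Fact dirsum_addC : commutative dirsum_add.
Proof. by move=> f g; apply/ffunP=> i; rewrite !ffunE addrC. Qed.
Fact dirsum_add0 : left_id dirsum_zero dirsum_add.
Proof. by move=> f; apply/ffunP=> i; rewrite !ffunE add0r. Qed.
Fact dirsum_addN : left_inverse dirsum_zero dirsum_opp dirsum_add.
Proof. by move=> f; apply/ffunP=> i; rewrite !ffunE addNr. Qed.

HB.instance Definition _ := GRing.isZmodule.Build dirsum
  dirsum_addA dirsum_addC dirsum_add0 dirsum_addN.

End DirectSum.

Definition zmod_isomorphic (U V : zmodType) : Prop :=
  exists f : {additive U -> V}, bijective f.

(* Main.v *)
Require Import Defs.
From HB Require Import structures.
From mathcomp Require Import all_boot all_order all_algebra.
From mathcomp Require Import boolp.
From mathcomp Require Import zify ring.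

Set Implicit Arguments.
Unset Strict Implicit.
Unset Printing Implicit Defensive.

Import Order.TTheory GRing.Theory Num.Theory.
Local Open Scope ring_scope.

(** In coordinates along the two diagonals the black cells form an array
    [B v i], [v <= n], [i < n], and the white cells an array [W w u], [w < n],
    [u <= n], with [W w u] adjacent to those of [B w u], [B w.+1 u],
    [B w u.-1] and [B w.+1 u.-1] that exist. The face condition says that the
    four signs around each interior lattice point have product -1, and this
    determines the signs up to changing the signs of whole rows and columns of
    the matrix ([kasteleyn_gauge]). Hence the cokernel is the abelian group with
    generators [a v i] ([v <= n], [i < n]) and one relation per white cell,
      [a w u + a w.+1 u + a w u.-1 - a w.+1 u.-1 = 0]
    (the terms that do not exist being dropped); see [coker_aztec_presented].

    Let [g v k = \sum_i a v i * 'C(i, k)] be the binomial transform of the row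
    [a v]. It is invertible over the integers, so that the [g v k] generate the
    same group, and in terms of them the relations become
      [g v.+1 k = g v k + 2 g v k.+1]   and   [2 g v 0 = 0]   for [v < n]
    ([btrans_relS], [btrans_rel0], and conversely [btrans_inv_rel]). The first
    family eliminates every row but [g 0]; taking finite differences in [v],
    the second one is then equivalent to [2 ^ k.+1 g 0 k = 0] for [k < n]. So
    the group is the direct sum of cyclic groups of orders [2], ..., [2 ^ n],
    generated by the [g 0 k] ([aztec_presented_iso]). That the orders are not
    smaller is seen from the solution [g v j = 'C(v, k - j) 2 ^ (k - j)] (0 for
    [j > k]) of the relations modulo [2 ^ k.+1], which for [v = 0] is [1] at
    [j = k] and vanishes at the other [j]. *)

(** * The binomial transform *)

Lemma alternating_bin_sum N j k : (j < N)%N ->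
  \sum_(i < N) (-1) ^+ (i + j) * ('C(j, i) * 'C(i, k))%:Z = (j == k)%:Z.
Proof.
elim: j N k => [|j IH] [|N] k // lt_jN.
  rewrite big_ord_recl big1 => [|i _]; last by rewrite bin_small // mul0n mulr0.
  by rewrite bin0 bin0n addr0 mul1r mul1n eq_sym.
have shift l : \sum_(i < N) (-1) ^+ (i.+1 + j.+1) * ('C(j, i) * 'C(i, l))%:Z
    = (j == l)%:Z.
  rewrite -(IH N l lt_jN); apply: eq_bigr => i _.
  by rewrite addSn addnS !exprS !mulN1r opprK.
transitivity (- \sum_(i < N.+1) (-1) ^+ (i + j) * ('C(j, i) * 'C(i, k))%:Z
   + \sum_(i < N) (-1) ^+ (i.+1 + j.+1) * ('C(j, i) * 'C(i.+1, k))%:Z).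
  rewrite big_ord_recl [in RHS]big_ord_recl !bin0 opprD -addrA; congr (_ + _).
    by rewrite !add0n exprS mulN1r mulNr.
  rewrite -sumrN -big_split /=; apply: eq_bigr => i _.
  rewrite binS mulnDl PoszD mulrDr; congr (_ + _).
  by rewrite /bump /= add1n addnS exprS mulN1r mulNr.
rewrite IH; last by lia.
case: k => [|k].
  rewrite [X in _ + X](_ : _ = (j == 0)%:Z) ?addNr // -(shift 0%N).
  by apply: eq_bigr => i _; rewrite !bin0.
rewrite [X in _ + X](_ : _ = (j == k.+1)%:Z + (j == k)%:Z).
  by rewrite addKr eqSS.
rewrite -(shift k.+1) -(shift k) -big_split; apply: eq_bigr => i _ /=.
by rewrite binS mulnDr PoszD mulrDr.
Qed.

(** The binomial transform of the first [n] terms of a sequence, and its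
    inverse. *)
Definition btrans (V : zmodType) n (a : nat -> V) k : V :=
  \sum_(i < n) a i *~ 'C(i, k)%:Z.

Definition btrans_inv (V : zmodType) n (g : nat -> V) i : V :=
  \sum_(j < n) g j *~ ((-1) ^+ (i + j) * 'C(j, i)%:Z).

Lemma sumrz_delta (V : zmodType) n (a : nat -> V) (c : nat -> int) i :
  (i < n)%N -> (forall j, (j < n)%N -> c j = (j == i)%:Z) ->
  \sum_(j < n) a j *~ c j = a i.
Proof.
move=> lt_in cE; rewrite (bigD1 (Ordinal lt_in)) //= cE // eqxx big1 ?addr0 //.
move=> j; rewrite -val_eqE /= => ne_ji; rewrite cE // (negbTE ne_ji).
exact: mulr0z.
Qed.

Lemma btransK (V : zmodType) n (a : nat -> V) i :
  (i < n)%N -> btrans_inv n (btrans n a) i = a i.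
Proof.
move=> lt_in; rewrite /btrans_inv /btrans.
under eq_bigr do rewrite mulrz_suml.
rewrite exchange_big /=.
under eq_bigr => j _ do under eq_bigr => k _ do rewrite -mulrzA.
under eq_bigr => j _ do rewrite -mulrz_sumr.
apply: (@sumrz_delta _ _ _ (fun j =>
  \sum_(k < n) 'C(j, k)%:Z * ((-1) ^+ (i + k) * 'C(k, i)%:Z))) => // j lt_jn.
rewrite -[RHS]mul1r.
transitivity ((-1) ^+ (i + j) * (j == i)%:Z : int); last first.
  by case: eqP => [->|]; rewrite ?mulr0 // addnn -mul2n exprM sqrrN expr1n.
rewrite -(alternating_bin_sum i lt_jn) mulr_sumr.
apply: eq_bigr => k _; rewrite PoszM !mulrA; congr (_ * _).
rewrite mulrC; congr (_ * _).
by rewrite -exprD addnACA !exprD -!exprMn mulrNN mul1r expr1n mulr1.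
Qed.

Lemma btrans_invK (V : zmodType) n (g : nat -> V) k :
  (k < n)%N -> btrans n (btrans_inv n g) k = g k.
Proof.
move=> lt_kn; rewrite /btrans_inv /btrans.
under eq_bigr do rewrite mulrz_suml.
rewrite exchange_big /=.
under eq_bigr => j _ do under eq_bigr => i _ do rewrite -mulrzA.
under eq_bigr => j _ do rewrite -mulrz_sumr.
apply: (@sumrz_delta _ _ _ (fun j =>
  \sum_(i < n) (-1) ^+ (i + j) * 'C(j, i)%:Z * 'C(i, k)%:Z)) => // j lt_jn.
rewrite -(alternating_bin_sum k lt_jn).
by apply: eq_bigr => i _; rewrite PoszM mulrA.
Qed.

(** * The relations and their binomial transform *)

(** The relation that the white cell [(w, u)] imposes on the black cells
    [(v, i)], after the signs have been normalized. The case [u = n] needs no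
    separate treatment: arrays are extended by 0 to the indices [i >= n]. *)
Definition aztec_relation (V : zmodType) (a : nat -> nat -> V) w u : V :=
  a w u + a w.+1 u + (if u is u'.+1 then a w u' - a w.+1 u' else 0).

(** The arrays, of size [n.+1] by [n], that satisfy the relations of the Aztec
    diamond of order [n]. *)
Definition aztec_array (V : zmodType) n (a : nat -> nat -> V) : Prop :=
  (forall v i, (n <= i)%N -> a v i = 0) /\
  (forall w u, (w < n)%N -> (u <= n)%N -> aztec_relation a w u = 0).

Section Transform.
Variables (V : zmodType) (n : nat) (a : nat -> nat -> V).
Hypothesis a_aztec : aztec_array n a.

Let a_ge : forall v i, (n <= i)%N -> a v i = 0 := a_aztec.1.
Let rel_a : forall w u, (w < n)%N -> (u <= n)%N -> aztec_relation a w u = 0 :=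
  a_aztec.2.

(* The transform of the shifted row; Pascal's rule expresses the transform of
   the row itself through it, and it is eliminated in the end. *)
Let tail v k : V := \sum_(i < n) a v i.+1 *~ 'C(i, k)%:Z.

Let btrans0 v : btrans n (a v) 0 = a v 0%N + tail v 0.
Proof.
rewrite /btrans /tail; under eq_bigr do rewrite bin0.
under [in RHS]eq_bigr do rewrite bin0.
rewrite -(big_mkord xpredT (fun i => a v i.+1 *~ 1)).
rewrite -(big_mkord xpredT (fun i => a v i *~ 1)).
rewrite -[in RHS](mulr1z (a v 0)).
rewrite -(big_nat_recl n 0 (fun i => a v i *~ 1)) // big_nat_recr //=.
by rewrite a_ge // mul0rz addr0.
Qed.

Let btransS v k : btrans n (a v) k.+1 = tail v k.+1 + tail v k.
Proof.
transitivity (\sum_(i < n.+1) a v i *~ 'C(i, k.+1)%:Z).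
  by rewrite big_ord_recr /= a_ge // mul0rz addr0.
rewrite big_ord_recl /= bin0n mulr0z add0r -big_split; apply: eq_bigr => i _ /=.
by rewrite /bump /= add1n binS PoszD mulrzDr.
Qed.

Let tail_rel w k : (w < n)%N ->
  btrans n (a w) k + tail w k = btrans n (a w.+1) k - tail w.+1 k.
Proof.
move=> lt_wn; rewrite -sumrN -!big_split; apply: eq_bigr => i _ /=.
rewrite -mulNrz -!mulrzDl; congr (_ *~ _).
have /= relS := rel_a lt_wn (ltn_ord i); rewrite /= in relS.
by apply/eqP; rewrite -subr_eq0 -relS opprB [a w i + _]addrC addrACA.
Qed.

Let tail_sum v k : (v < n)%N ->
  tail v.+1 k + tail v k = btrans n (a v) k.+1 *+ 2.
Proof.
move=> lt_vn; have := tail_rel k.+1 lt_vn.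
rewrite [btrans n (a v.+1) _]btransS addrAC subrr add0r => <-.
by rewrite -addrA -btransS mulr2n.
Qed.

Lemma btrans_relS v k : (v < n)%N ->
  btrans n (a v.+1) k = btrans n (a v) k + btrans n (a v) k.+1 *+ 2.
Proof.
move=> lt_vn; rewrite -tail_sum // [tail _ _ + _]addrC addrA tail_rel //.
by rewrite subrK.
Qed.

Lemma btrans_rel0 v : (v < n)%N -> btrans n (a v) 0 *+ 2 = 0.
Proof.
move=> lt_vn; have /= := rel_a lt_vn (leq0n n); rewrite /aztec_relation addr0.
have := tail_rel 0 lt_vn; rewrite [btrans _ (a _.+1) _]btrans0 addrK => {1}<-.
by rewrite addrCA -btrans0 mulr2n.
Qed.

(** By [btrans_relS], [2 g v k.+1] is the difference of [g v.+1 k] and [g v k];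
    this consumes one row for each additional factor 2. *)
Lemma btrans_torsion v k : (v + k < n)%N -> btrans n (a v) k *+ 2 ^ k.+1 = 0.
Proof.
elim: k v => [|k IH] v lt_vkn; first by rewrite btrans_rel0 //; lia.
have lt_vn : (v < n)%N by lia.
have -> : btrans n (a v) k.+1 *+ 2 ^ k.+2 =
   (btrans n (a v.+1) k - btrans n (a v) k) *+ 2 ^ k.+1.
  by rewrite btrans_relS // addrAC subrr add0r -mulrnA -expnS.
by rewrite mulrnBl !IH ?subrr //; lia.
Qed.

End Transform.

Lemma btrans_inv_ge (V : zmodType) n (g : nat -> V) i :
  (n <= i)%N -> btrans_inv n g i = 0.
Proof.
move=> le_ni; rewrite /btrans_inv big1 // => j _.
by rewrite bin_small ?mulr0 ?mulr0z // (leq_trans (ltn_ord j)).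
Qed.

Section InverseTransform.
Variables (V : zmodType) (n : nat) (g : nat -> nat -> V).
Hypothesis g_ge : forall v k, (n <= k)%N -> g v k = 0.
Hypothesis g_relS : forall v k, (v < n)%N -> g v.+1 k = g v k + g v k.+1 *+ 2.
Hypothesis g_rel0 : forall v, (v < n)%N -> g v 0%N *+ 2 = 0.

Lemma btrans_inv_rel : aztec_array n (fun v => btrans_inv n (g v)).
Proof.
split=> [v i|w u lt_wn _]; first exact: btrans_inv_ge.
(* Eliminating [g w.+1] turns each relation into a telescoping sum. *)
rewrite /aztec_relation /btrans_inv; case: u => [|u].
  pose h j := g w j *~ (- 2 * (-1) ^+ j).
  rewrite addr0 -big_split; transitivity (\sum_(0 <= j < n) (h j.+1 - h j)).
    rewrite big_mkord; apply: eq_bigr => j _ /=; rewrite g_relS // bin0.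
    rewrite pmulrn mulrzDl -mulrzA addrA -mulrzDr /h -mulrNz addrC exprS.
    by congr (_ *~ _ + _ *~ _); ring.
  rewrite telescope_sumr // /h g_ge // mul0rz sub0r.
  by rewrite mulr1 mulrNz opprK -pmulrn g_rel0.
pose h j := g w j *~ (- 2 * (-1) ^+ (u.+1 + j) * 'C(j, u.+1)%:Z).
rewrite -sumrN -!big_split; transitivity (\sum_(0 <= j < n) (h j.+1 - h j)).
  rewrite big_mkord; apply: eq_bigr => j _ /=; rewrite g_relS //.
  rewrite pmulrn !mulrzDl opprD addNKr addrA -addrA -!mulrzDr -mulrzBr.
  rewrite /h -mulrNz addrC binS PoszD addSn addnS !exprS.
  by congr (_ *~ _ + _ *~ _); ring.
by rewrite telescope_sumr // /h g_ge // mul0rz bin0n mulr0 mulr0z subrr.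
Qed.

End InverseTransform.

(** * Direct sums of cyclic groups *)

Lemma dirsumDE (I : finType) (V : I -> zmodType) (f g : dirsum V) i :
  (f + g) i = f i + g i.
Proof. exact: ffunE. Qed.

Definition dirsum_proj (I : finType) (V : I -> zmodType) i (f : dirsum V) :
  V i := f i.

Fact dirsum_proj_is_additive (I : finType) (V : I -> zmodType) i :
  zmod_morphism (@dirsum_proj I V i).
Proof.
by move=> f g; rewrite /dirsum_proj dirsumDE; congr (_ + _); apply: ffunE.
Qed.

HB.instance Definition _ (I : finType) (V : I -> zmodType) i :=
  GRing.isZmodMorphism.Build (dirsum V) (V i) (@dirsum_proj I V i)
    (@dirsum_proj_is_additive I V i).

Lemma dirsum_projP (I : finType) (V : I -> zmodType) (f g : dirsum V) :
  (forall i, dirsum_proj i f = dirsum_proj i g) -> f = g.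
Proof. by move=> eq_fg; apply/ffunP=> i; apply: eq_fg. Qed.

Lemma mulrz_Zp (U : zmodType) (x : U) m (c : int) :
  (1 < m)%N -> x *+ m = 0 -> x *~ c = x *+ (c%:~R : 'Z_m).
Proof.
move=> m_gt1 xm0; have m_neq0 : m%:Z != 0 by lia.
have [r rE] : exists r : nat, (c %% m)%Z = r%:Z.
  by exists `|(c %% m)%Z|%N; rewrite gez0_abs // modz_ge0.
have lt_rm : (r < m)%N by rewrite -ltz_nat -rE ltz_pmod //; lia.
have cE : c = m%:Z * (c %/ m)%Z + r%:Z by rewrite mulrC -rE -divz_eq.
rewrite cE mulrzDr mulrzA -pmulrn xm0 mul0rz add0r.
have -> : (m%:Z * (c %/ m)%Z + r%:Z)%:~R = r%:R :> 'Z_m.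
  by rewrite intrD intrM -pmulrn pchar_Zp // mul0r add0r.
by rewrite val_Zp_nat // modn_small.
Qed.

Lemma mulrz_signK (U : zmodType) (x : U) (t : bool) :
  x *~ (-1) ^+ t *~ (-1) ^+ t = x.
Proof. by rewrite -mulrzA -signr_addb addbb. Qed.

(** If generators [g i] of [U], killed by [m i], are mapped by an additive [f]
    to the standard basis of the direct sum of the cyclic groups of orders
    [m i], then [f] is an isomorphism. *)
Section CyclicSummands.
Variables (n : nat) (m : 'I_n -> nat) (U : zmodType).
Let T := dirsum (fun i => 'Z_(m i)).
Variables (f : {additive U -> T}) (g : 'I_n -> U).
Hypothesis m_gt1 : forall i, (1 < m i)%N.
Hypothesis f_g : forall i j, dirsum_proj i (f (g j)) = (i == j)%:R.
Hypothesis g_torsion : forall i, g i *+ m i = 0.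
Hypothesis g_gen : forall u, exists c : 'I_n -> int, u = \sum_i g i *~ c i.

Lemma bijective_cyclic_summands : bijective f.
Proof.
have f_sum (c : 'I_n -> int) i :
    dirsum_proj i (f (\sum_j g j *~ c j)) = (c i)%:~R.
  rewrite !raddf_sum (bigD1 i) //= big1 ?addr0 => [|j ne_ji].
    by rewrite !raddfMz /= f_g eqxx.
  by rewrite !raddfMz /= f_g eq_sym (negbTE ne_ji) mul0rz.
exists (fun t : T => \sum_i g i *~ (dirsum_proj i t : nat)%:Z) => [u|t].
  have [c ->] := g_gen u; apply: eq_bigr => i _.
  by rewrite f_sum -pmulrn -mulrz_Zp.
by apply: dirsum_projP => i; rewrite f_sum -pmulrn natr_Zp.
Qed.

End CyclicSummands.

(** * Homomorphisms from a cokernel *)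

(** The projection onto the cokernel. *)
Definition coker_pi p k (M : 'M[int]_(p, k)) (x : 'cV[int]_p) : coker M :=
  \pi_(coker M)%qT x.

Fact coker_pi_is_additive p k (M : 'M[int]_(p, k)) :
  zmod_morphism (coker_pi M).
Proof. exact: (pi_is_zmod_morphism (Quotient.quot (immx M))). Qed.

HB.instance Definition _ p k (M : 'M[int]_(p, k)) :=
  GRing.isZmodMorphism.Build 'cV[int]_p (coker M) (coker_pi M)
    (coker_pi_is_additive M).

Lemma coker_pi_im p k (M : 'M[int]_(p, k)) u : coker_pi M (M *m u) = 0.
Proof.
rewrite -[RHS](raddf0 (coker_pi M)); apply/eqP.
by rewrite -Quotient.idealrBE subr0; apply/asboolP; exists u.
Qed.

Lemma coker_pi_surj p k (M : 'M[int]_(p, k)) q : exists x, q = coker_pi M x.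
Proof. by exists (repr q); rewrite /coker_pi reprK. Qed.

Lemma coker_lift p k (M : 'M[int]_(p, k)) (V : zmodType) (h : 'I_p -> V) :
    (forall j, \sum_r h r *~ M r j = 0) ->
  exists f : {additive coker M -> V},
    forall x, f (coker_pi M x) = \sum_r h r *~ x r 0.
Proof.
move=> hM0; pose F (x : 'cV[int]_p) := \sum_r h r *~ x r 0.
have FB x y : F (x - y) = F x - F y.
  by rewrite /F -sumrB; apply: eq_bigr => r _; rewrite !mxE mulrzBr.
have F_im x : x \in immx M -> F x = 0.
  move=> /asboolP[u ->]; rewrite /F.
  under eq_bigr => r _ do rewrite mxE mulrz_sumr.
  rewrite exchange_big big1 //= => j _.
  under eq_bigr => r _ do rewrite mulrzA.
  by rewrite -mulrz_suml hM0 mul0rz.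
pose f (q : coker M) := F (repr q).
have f_pi x : f (coker_pi M x) = F x.
  by apply/eqP; rewrite -subr_eq0 -FB F_im // Quotient.idealrBE reprK.
have f_add : zmod_morphism f.
  move=> q q'; have [x ->] := coker_pi_surj q; have [y ->] := coker_pi_surj q'.
  by rewrite -raddfB !f_pi FB.
by exists (HB.pack_for {additive coker M -> V} f
  (GRing.isZmodMorphism.Build _ _ f f_add)).
Qed.

(** * The group presented by the Aztec relations *)

(** [U] is the abelian group presented by the entries of an [n.+1] by [n] array
    subject to the Aztec relations: it contains such an array [a], which
    generates it (every subgroup containing the entries is the whole group) and
    is universal. *)
Definition aztec_presented n (U : zmodType) : Prop :=
  exists a : nat -> nat -> U,
  [/\ aztec_array n a,
      forall P : U -> Prop, P 0 -> (forall x y, P x -> P y -> P (x - y)) ->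
        (forall v i, (v <= n)%N -> (i < n)%N -> P (a v i)) -> forall x, P x
    & forall (V : zmodType) (b : nat -> nat -> V), aztec_array n b ->
        exists f : {additive U -> V},
          forall v i, (v <= n)%N -> (i < n)%N -> f (a v i) = b v i].

Lemma aztec_presented_iso n (U : zmodType) : aztec_presented n U ->
  zmod_isomorphic U (dirsum (fun i : 'I_n => 'Z_(2 ^ i.+1))).
Proof.
set T := dirsum _.
case=> a [a_aztec a_gen a_univ].
(* [c v j k] is the coefficient of degree [k] in [x ^ j * (1 + 2 x) ^ v], which
   solves [g v.+1 j = g v j + 2 g v j.+1] over the integers. *)
pose c v j k : nat :=
  if (j <= k)%N then ('C(v, k - j) * 2 ^ (k - j))%N else 0%N.
pose g v j : T := [ffun k : 'I_n => (c v j k)%:R].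
have gE v j (k : 'I_n) : dirsum_proj k (g v j) = (c v j k)%:R by exact: ffunE.
have g_ge v j : (n <= j)%N -> g v j = 0.
  move=> le_nj; apply: dirsum_projP => k; rewrite gE raddf0 /c leqNgt.
  by rewrite (leq_trans (ltn_ord k)).
have g_relS v j : (v < n)%N -> g v.+1 j = g v j + g v j.+1 *+ 2.
  move=> _; apply: dirsum_projP => k; rewrite raddfD raddfMn /= !gE.
  rewrite -mulrnA -natrD; congr _%:R; rewrite /c.
  have [lt_jk|lt_kj|<-] := ltngtP j k; first 1 last.
  - by [].
  - by rewrite subnn !bin0.
  have -> : (k - j = (k - j.+1).+1)%N by lia.
  by rewrite binS mulnDl; congr (_ + _)%N; rewrite expnSr mulnA.
have g_rel0 v : (v < n)%N -> g v 0%N *+ 2 = 0.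
  move=> _; apply: dirsum_projP => k.
  rewrite raddfMn raddf0 /= gE /c leq0n subn0.
  rewrite -mulrnA -mulnA -expnSr mulnC natrM pchar_Zp ?mul0r //.
  exact: (@ltn_exp2l 2 0).
have [f f_a] : exists f : {additive U -> T}, forall v i,
    (v <= n)%N -> (i < n)%N -> f (a v i) = btrans_inv n (g v) i.
  by apply: a_univ; apply: btrans_inv_rel.
exists f; apply: (bijective_cyclic_summands (g := btrans n (a 0))).
- by move=> i; exact: (@ltn_exp2l 2 0).
- move=> i j; rewrite raddf_sum.
  transitivity (dirsum_proj i (btrans n (btrans_inv n (g 0%N)) j)).
    by congr (dirsum_proj i _); apply: eq_bigr => l _; rewrite raddfMz f_a.
  rewrite btrans_invK // gE /c bin0n subn_eq0 -val_eqE eqn_leq.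
  case: leqP => //= le_ji; case: leqP => //= le_ij.
  by rewrite (eqP (_ : i - j == 0)%N) ?subn_eq0.
- by move=> i; apply: btrans_torsion => //; rewrite add0n.
apply: a_gen.
- by exists (fun _ => 0); rewrite big1.
- move=> x y [cx ->] [cy ->]; exists (fun i => cx i - cy i).
  by rewrite -sumrB; apply: eq_bigr => i _; rewrite mulrzBr.
have gen_D (x y : U) (cx : int) :
   (exists c, x = \sum_i btrans n (a 0) (i : 'I_n) *~ c i) ->
   (exists c, y = \sum_i btrans n (a 0) (i : 'I_n) *~ c i) ->
   exists c, x + y *~ cx = \sum_i btrans n (a 0) (i : 'I_n) *~ c i.
  move=> [dx ->] [dy ->]; exists (fun i => dx i + dy i * cx).
  rewrite mulrz_suml -big_split; apply: eq_bigr => i _ /=.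
  by rewrite mulrzDr mulrzA.
have gen_bintr v k : (v <= n)%N ->
   exists c, btrans n (a v) k = \sum_i btrans n (a 0) (i : 'I_n) *~ c i.
  elim: v k => [|v IH] k le_vn.
    have [lt_kn|le_nk] := ltnP k n.
      exists (fun i : 'I_n => ((i : nat) == k)%:Z); symmetry.
      exact: (@sumrz_delta _ _ _ (fun i => (i == k)%:Z)).
    exists (fun _ => 0); rewrite [RHS]big1 // /btrans big1 // => i _.
    by rewrite bin_small // (leq_trans (ltn_ord i)).
  rewrite (btrans_relS a_aztec) // [_ *+ 2]pmulrn.
  by apply: gen_D; apply: IH; apply: ltnW.
move=> v i le_vn lt_in; rewrite -(btransK (a v) lt_in) /btrans_inv.
apply: (big_ind
  (fun x => exists c, x = \sum_i btrans n (a 0) (i : 'I_n) *~ c i)).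
- by exists (fun _ => 0); rewrite big1.
- by move=> x y Px Py; rewrite -[y]mulr1z; apply: gen_D.
move=> j _; rewrite -[_ *~ _]add0r; apply: gen_D; last exact: gen_bintr.
by exists (fun _ => 0); rewrite big1.
Qed.
(** * Signs around the faces *)

(** The four cells around a lattice point are the corners of a finite face, with
    four sides, of the dual graph. *)
Lemma kasteleyn_face (P : {pred cell}) neg a b :
  kasteleyn_signs P neg ->
  (a, b) \in P -> (a + 1, b) \in P -> (a + 1, b + 1) \in P ->
  (a, b + 1) \in P ->
  neg (a, b) (a + 1, b) (+) neg (a + 1, b) (a + 1, b + 1)
    (+) neg (a + 1, b + 1) (a, b + 1) (+) neg (a, b + 1) (a, b).
Proof.
move=> [_ neg_face] P00 P10 P11 P01.
pose c := [:: ((a, b), (a + 1, b)); ((a + 1, b), (a + 1, b + 1));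
              ((a + 1, b + 1), (a, b + 1)); ((a, b + 1), (a, b))].
have face_c : finite_face P c.
  have aE : a + 1 - a = 1 by ring.
  have bE : b + 1 - b = 1 by ring.
  have aE' : a - (a + 1) = -1 by ring.
  have bE' : b - (b + 1) = -1 by ring.
  split.
  - by rewrite /= /dart /share_side /= P00 P10 P11 P01 !subrr aE bE aE' bE'.
  - have succ_neq (z : int) : (z + 1 == z) = false by lia.
    apply/andP; split; last first.
      by rewrite /= !inE !xpair_eqE ![_ == _ + 1]eq_sym !succ_neq /= ?andbF.
    have next x y x' y' x2 y2 : x' - (y' - y) = x2 -> y' + (x' - x) = y2 ->
        (x2, y2) \in P -> face_next P ((x, y), (x', y')) = ((x', y'), (x2, y2)).
      by move=> <- <- eP; rewrite /face_next /= eP.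
    rewrite /= (next a b (a + 1) b (a + 1) (b + 1)) //; [|ring|ring].
    rewrite (next (a + 1) b (a + 1) (b + 1) a (b + 1)) //; [|ring|ring].
    rewrite (next (a + 1) (b + 1) a (b + 1) a b) //; [|ring|ring].
    by rewrite (next a (b + 1) a b (a + 1) b) ?eqxx //; ring.
  - rewrite /area2 !big_cons big_nil /=.
    rewrite [X in 0 < X](_ : _ = 2) //; ring.
have := neg_face c face_c; rewrite /= addn0.
by case: (neg _ _); case: (neg _ _); case: (neg _ _); case: (neg _ _).
Qed.

(** * The cells in diagonal coordinates *)

(** The reflection of the cells in the horizontal axis, if [e] holds. It
    preserves the Aztec diamond and exchanges the two colors, so that it reduces
    one choice of the black color to the other. *)
Definition flip (e : bool) (s : cell) : cell :=
  if e then (s.1, -1 - s.2) else s.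

(** The cells in coordinates along the two diagonals. With [e] chosen according
    to the black color, the black cells of the diamond are those with [v <= n]
    and [i < n], and the white ones those with [w < n] and [u <= n]. *)
Definition black_cell n e v i : cell :=
  flip e (v%:Z - i%:Z - 1, v%:Z + i%:Z - n%:Z).

Definition white_cell n e w u : cell :=
  flip e (w%:Z - u%:Z, w%:Z + u%:Z - n%:Z).

Lemma flipK e : involutive (flip e).
Proof. by case: e => -[a b] //; congr (_, _) => /=; ring. Qed.

Lemma mem_aztec n a b : ((a, b) \in aztec_diamond n) =
  (`|a + b + 1| <= n%:Z) && (`|a - b| <= n%:Z).
Proof. by rewrite !inE /= andbT !addr0; lia. Qed.

Lemma mem_flip_aztec n e s :
  (flip e s \in aztec_diamond n) = (s \in aztec_diamond n).
Proof.
by case: e => //; case: s => a b; rewrite /flip !mem_aztec /=; lia.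
Qed.

Lemma share_side_flip e s t : share_side (flip e s) (flip e t) = share_side s t.
Proof.
by case: e s t => -[a b] [a' b'] //; rewrite /share_side /=; lia.
Qed.

Lemma face_flip n e neg a b :
  kasteleyn_signs (aztec_diamond n) neg ->
  (a, b) \in aztec_diamond n -> (a + 1, b) \in aztec_diamond n ->
  (a + 1, b + 1) \in aztec_diamond n -> (a, b + 1) \in aztec_diamond n ->
  neg (flip e (a, b)) (flip e (a + 1, b))
    (+) neg (flip e (a + 1, b)) (flip e (a + 1, b + 1))
    (+) neg (flip e (a + 1, b + 1)) (flip e (a, b + 1))
    (+) neg (flip e (a, b + 1)) (flip e (a, b)).
Proof.
case: e => [|Kneg P00 P10 P11 P01]; last first.
  exact: (kasteleyn_face Kneg P00 P10 P11 P01).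
(* The reflected square has its lower left corner at [flip true (a, b + 1)]. *)
move=> Kneg; rewrite -(mem_flip_aztec n true) => P01.
rewrite -(mem_flip_aztec n true) => P11.
rewrite -(mem_flip_aztec n true) => P10.
rewrite -(mem_flip_aztec n true) => P00; move: P01 P11 P10 P00 => /=.
have -> : -1 - b = -1 - (b + 1) + 1 by ring.
move=> P01 P11 P10 P00; have := kasteleyn_face Kneg P00 P10 P11 P01.
have [neg_sym _] := Kneg; move: (-1 - (b + 1)) => d.
rewrite (neg_sym (a, d) (a + 1, d)) (neg_sym (a + 1, d) (a + 1, _)).
rewrite (neg_sym (a + 1, d + 1) (a, _)) (neg_sym (a, d + 1) (a, d)).
by do 4!case: (neg _ _).
Qed.

Lemma mem_black_flip c e s :
  (flip e s \in black c) = (odd `|(s.1 + s.2)%R|%N == (e (+) c)).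
Proof. by case: s e c => a b [] []; rewrite /flip inE /=; lia. Qed.

Lemma mem_white c s : (s \in white c) = (s \notin black c).
Proof. by []. Qed.

Section Cells.
Variables (n : nat) (c : bool).
Let e := odd n == c.

Let odd_addb : e (+) c = ~~ odd n.
Proof. by rewrite /e; case: (odd n) c => -[]. Qed.

Lemma black_cell_in v i : (v <= n)%N -> (i < n)%N ->
  black_cell n e v i \in [predI aztec_diamond n & black c].
Proof.
move=> le_vn lt_in; rewrite inE /= mem_flip_aztec mem_aztec mem_black_flip.
by rewrite odd_addb /=; apply/andP; split; lia.
Qed.

Lemma black_cellP s : s \in [predI aztec_diamond n & black c] ->
  exists v i, [/\ (v <= n)%N, (i < n)%N & s = black_cell n e v i].
Proof.
rewrite inE /= -(flipK e s) mem_flip_aztec mem_black_flip odd_addb.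
case: (flip e s) => a b; rewrite mem_aztec /= => /andP[sA sB].
have [k abE] : exists k : int, a + b = k * 2 - n%:Z - 1.
  by exists ((a + b + n%:Z + 1) %/ 2)%Z; lia.
exists `|k|%N, `|(b - k + n%:Z)%R|%N.
by split; [lia | lia | congr (flip e (_, _)); lia].
Qed.

Lemma white_cell_in w u : (w < n)%N -> (u <= n)%N ->
  white_cell n e w u \in [predI aztec_diamond n & white c].
Proof.
move=> lt_wn le_un; rewrite inE /= mem_flip_aztec mem_aztec.
rewrite mem_white mem_black_flip odd_addb /=.
by apply/andP; split; lia.
Qed.

Lemma white_cellP s : s \in [predI aztec_diamond n & white c] ->
  exists w u, [/\ (w < n)%N, (u <= n)%N & s = white_cell n e w u].
Proof.
rewrite inE /= mem_white -(flipK e s) mem_flip_aztec mem_black_flip odd_addb.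
case: (flip e s) => a b; rewrite mem_aztec /= => /andP[sA sB].
have [k abE] : exists k : int, a + b = k * 2 - n%:Z.
  by exists ((a + b + n%:Z) %/ 2)%Z; lia.
exists `|k|%N, `|(b - k + n%:Z)%R|%N.
by split; [lia | lia | congr (flip e (_, _)); lia].
Qed.

End Cells.

Lemma share_side_black_white n e v i w u :
  share_side (black_cell n e v i) (white_cell n e w u) =
    ((v == w) || (v == w.+1)) && ((i == u) || (i.+1 == u)).
Proof. by rewrite share_side_flip /share_side /=; lia. Qed.

Lemma black_cell_eq n e v i v' i' :
  (black_cell n e v i == black_cell n e v' i') = (v == v') && (i == i').
Proof. by rewrite (inj_eq (inv_inj (flipK e))) xpair_eqE; lia. Qed.

(** * Normalization of the signs *)

(** Here [nL w u], [nU w u], [nD w u] and [nR w u] are the signs of the edges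
    from [W w u] to [B w u] and to [B w.+1 u], and from [W w u.+1] to [B w u]
    and to [B w.+1 u]. The hypotheses are the face condition at the two kinds of
    interior lattice points. After multiplication by [tau v i] at [B v i] and
    [eps w u] at [W w u], exactly the edges with sign [nR] are negative. *)
Lemma kasteleyn_gauge n (nL nU nD nR : nat -> nat -> bool) :
  (forall w u, (w < n)%N -> (u < n)%N ->
     nL w u (+) nU w u (+) nD w u (+) nR w u) ->
  (forall w u, (w.+1 < n)%N -> (u.+1 < n)%N ->
     nR w u (+) nU w u.+1 (+) nD w.+1 u (+) nL w.+1 u.+1) ->
  exists tau eps : nat -> nat -> bool, forall w u, (w < n)%N -> (u < n)%N ->
    [/\ nL w u = tau w u (+) eps w u, nU w u = tau w.+1 u (+) eps w u,
        nD w u = tau w u (+) eps w u.+1 &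
        nR w u = ~~ (tau w.+1 u (+) eps w u.+1)].
Proof.
move=> face_odd face_even.
(* [tau] is propagated first along the row [v = 0], using the edges at
   [W 0 u.+1], and then along each column, using the edges at [W v u]. *)
pose fix row u :=
  if u is u'.+1 then row u' (+) nD 0 u' (+) nL 0 u'.+1 else false.
pose fix tau w u {struct w} :=
  if w is w'.+1 then tau w' u (+) nL w' u (+) nU w' u else row u.
(* The last white cell of a row, [u = n], has no edge of sign [nL]. *)
pose eps w u :=
  if (u < n)%N then tau w u (+) nL w u else tau w u.-1 (+) nD w u.-1.
have tau_col w u : (w < n)%N -> (u.+1 < n)%N ->
  tau w u.+1 = tau w u (+) nD w u (+) nL w u.+1.
  elim: w => [//|w IH] lt_wn lt_un /=.
  have lt_wn' := ltnW lt_wn; have lt_un' := ltnW lt_un.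
  rewrite IH //; move: (face_odd w u lt_wn' lt_un') (face_even w u lt_wn lt_un).
  move: (tau w u) (nL w u) (nU w u) (nD w u) (nR w u) (nU w u.+1) (nD w.+1 u).
  by move: (nL w.+1 u.+1) (nL w u.+1); do 9!case.
exists tau, eps => w u lt_wn lt_un; rewrite /eps lt_un /=.
have -> : (if (u.+1 < n)%N then tau w u.+1 (+) nL w u.+1
           else tau w u (+) nD w u) = tau w u (+) nD w u.
  by case: ifP => // lt_un'; rewrite tau_col // addbK.
move: (face_odd w u lt_wn lt_un).
by move: (tau w u) (nL w u) (nU w u) (nD w u) (nR w u); do 5!case.
Qed.

(** * The cokernel of a Kasteleyn-Percus matrix of the Aztec diamond *)

Section Presentation.


Variables (n p k : nat) (M : 'M[int]_(p, k)).
Variables (c : bool) (neg : rel cell) (b : p.-tuple cell) (w : k.-tuple cell).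
Hypothesis Kneg : kasteleyn_signs (aztec_diamond n) neg.
Hypothesis b_uniq : uniq b.
Hypothesis b_mem : b =i [predI aztec_diamond n & black c].
Hypothesis w_mem : w =i [predI aztec_diamond n & white c].
Hypothesis M_def : forall i j, let s := tnth b i in let t := tnth w j in
  M i j = (share_side s t && ~~ neg s t)%:Z - (share_side s t && neg s t)%:Z.
Let e := odd n == c.
Let B := black_cell n e.
Let W := white_cell n e.

Let gauge (tau eps : nat -> nat -> bool) : Prop :=
  forall y u, (y < n)%N -> (u < n)%N ->
  [/\ neg (B y u) (W y u) = tau y u (+) eps y u,
      neg (B y.+1 u) (W y u) = tau y.+1 u (+) eps y u,
      neg (B y u) (W y u.+1) = tau y u (+) eps y u.+1 &
      neg (B y.+1 u) (W y u.+1) = ~~ (tau y.+1 u (+) eps y u.+1)].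

Let gauge_exists : exists tau eps, gauge tau eps.
Proof.
have [neg_sym _] := Kneg.
apply: (@kasteleyn_gauge n (fun y u => neg (B y u) (W y u))
  (fun y u => neg (B y.+1 u) (W y u)) (fun y u => neg (B y u) (W y u.+1))
  (fun y u => neg (B y.+1 u) (W y u.+1))) => y u lt_yn lt_un.
  have := face_flip e (a := y%:Z - u%:Z - 1) (b := y%:Z + u%:Z - n%:Z) Kneg.
  have -> : y%:Z - u%:Z - 1 + 1 = y%:Z - u%:Z by lia.
  rewrite -/(B y u) -/(W y u).
  have -> : flip e (y%:Z - u%:Z - 1, y%:Z + u%:Z - n%:Z + 1) = W y u.+1.
    by congr (flip e (_, _)); lia.
  have -> : flip e (y%:Z - u%:Z, y%:Z + u%:Z - n%:Z + 1) = B y.+1 u.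
    by congr (flip e (_, _)); lia.
  rewrite !mem_aztec (neg_sym (W y u)) (neg_sym (W y u.+1)) => face.
  have : neg (B y u) (W y u) (+) neg (B y.+1 u) (W y u) (+)
     neg (B y.+1 u) (W y u.+1) (+) neg (B y u) (W y u.+1).
    by apply: face; lia.
  by do 4!case: (neg _ _).
have := face_flip e (a := y%:Z - u%:Z - 1) (b := y%:Z + u.+1%:Z - n%:Z) Kneg.
have -> : y%:Z - u%:Z - 1 + 1 = y%:Z - u%:Z by lia.
have -> : flip e (y%:Z - u%:Z - 1, y%:Z + u.+1%:Z - n%:Z) = W y u.+1.
  by congr (flip e (_, _)); lia.
have -> : flip e (y%:Z - u%:Z, y%:Z + u.+1%:Z - n%:Z) = B y.+1 u.
  by congr (flip e (_, _)); lia.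
have -> : flip e (y%:Z - u%:Z - 1, y%:Z + u.+1%:Z - n%:Z + 1) = B y.+1 u.+1.
  by congr (flip e (_, _)); lia.
have -> : flip e (y%:Z - u%:Z, y%:Z + u.+1%:Z - n%:Z + 1) = W y.+1 u.+1.
  by congr (flip e (_, _)); lia.
rewrite !mem_aztec (neg_sym (W y u.+1)) (neg_sym (W y.+1 u.+1)) => face.
have : neg (B y.+1 u) (W y u.+1) (+) neg (B y.+1 u) (W y.+1 u.+1) (+)
   neg (B y.+1 u.+1) (W y.+1 u.+1) (+) neg (B y.+1 u.+1) (W y u.+1).
  by apply: face; lia.
by do 4!case: (neg _ _).
Qed.

(* The black neighbors of [W y u]. *)
Let nbrs y u : seq cell :=
  (if (u < n)%N then [:: B y u; B y.+1 u] else [::]) ++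
  (if u is u'.+1 then [:: B y u'; B y.+1 u'] else [::]).

Let nbrsP y u : (y < n)%N -> (u <= n)%N ->
  perm_eq [seq s <- b | share_side s (W y u)] (nbrs y u).
Proof.
move=> lt_yn le_un; apply: uniq_perm; first exact: filter_uniq.
  rewrite /nbrs; case: u le_un => [|u] le_un; case: ifP => // _;
  rewrite /= ?inE /B ?black_cell_eq; lia.
move=> s; rewrite mem_filter b_mem.
apply/andP/idP => [[sW /black_cellP[v [i [le_vn lt_in sE]]]]|].
  move: sW; rewrite sE share_side_black_white /nbrs => vi.
  case: u le_un vi => [|u] le_un vi; case: ifP => lt_un;
  rewrite /= ?inE /B ?black_cell_eq; lia.
rewrite /nbrs mem_cat => s_nbr.
have [v [i [le_vn lt_in vi ->]]] : exists v i, [/\ (v <= n)%N, (i < n)%N,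
    ((v == y) || (v == y.+1)) && ((i == u) || (i.+1 == u)) & s = B v i].
  case/orP: s_nbr => [|].
    case: ifP => // lt_un; rewrite !in_cons in_nil orbF.
    by case/orP=> /eqP->; [exists y, u | exists y.+1, u]; split=> //; lia.
  case: u le_un => // u le_un; rewrite !in_cons in_nil orbF.
  by case/orP=> /eqP->; [exists y, u | exists y.+1, u]; split=> //; lia.
split; last exact: black_cell_in.
by rewrite share_side_black_white.
Qed.

(* The column of [M] indexed by [W y u], evaluated on a function [h] of the
   black cells, is up to sign the relation at [(y, u)] between the values of
   [h] corrected by [tau]. *)
Let column_sum (tau eps : nat -> nat -> bool) (V : zmodType) (h : cell -> V)
    (a : nat -> nat -> V) j y u :
  gauge tau eps ->
  (forall v i, (n <= i)%N -> a v i = 0) ->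
  (forall v i, (v <= n)%N -> (i < n)%N ->
    h (B v i) = a v i *~ (-1) ^+ tau v i) ->
  (y < n)%N -> (u <= n)%N -> tnth w j = W y u ->
  \sum_r h (tnth b r) *~ M r j = aztec_relation a y u *~ (-1) ^+ eps y u.
Proof.
move=> tauP a_ge hB lt_yn le_un wE; have le_yn := ltnW lt_yn.
transitivity (\sum_(s <- b) if share_side s (W y u)
    then h s *~ (-1) ^+ neg s (W y u) else 0).
  rewrite big_tuple; apply: eq_bigr => r _; rewrite M_def /= wE.
  by case: share_side; case: (neg _ _).
rewrite -big_mkcond -big_filter (perm_big _ (nbrsP lt_yn le_un)) /nbrs /=.
have hE v i t : (v <= n)%N -> (i < n)%N ->
  h (B v i) *~ (-1) ^+ (tau v i (+) t) = a v i *~ (-1) ^+ t.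
  by move=> le_vn lt_in; rewrite hB // signr_addb mulrzA mulrz_signK.
rewrite big_cat mulrzDl /=; congr (_ + _).
  case: ifP => [lt_un|/negbT]; last first.
    by rewrite -leqNgt => ?; rewrite big_nil !a_ge // addr0 mul0rz.
  have [EL EU _ _] := tauP y u lt_yn lt_un.
  by rewrite !big_cons big_nil /= addr0 EL EU !hE ?mulrzDl.
case: u le_un {wE} => [|u] le_un; first by rewrite big_nil mul0rz.
have [_ _ ED ER] := tauP y u lt_yn le_un.
rewrite !big_cons big_nil /= addr0 ED ER -addbT -addbA !hE //.
by rewrite signr_addb mulrN1 mulrNz mulrzBl.
Qed.

Lemma coker_aztec_presented : aztec_presented n (coker M).
Proof.
have [tau [eps tauP]] := gauge_exists.
(* The basis vector of the row indexed by the cell [s]. *)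
pose delta s : 'cV[int]_p := \col_r (tnth b r == s)%:Z.
pose a v i :=
  if (i < n)%N then coker_pi M (delta (B v i)) *~ (-1) ^+ tau v i else 0.
have a_ge v i : (n <= i)%N -> a v i = 0 by rewrite /a ltnNge => ->.
have deltaE v i :
    (i < n)%N -> coker_pi M (delta (B v i)) = a v i *~ (-1) ^+ tau v i.
  by rewrite /a => ->; rewrite mulrz_signK.
have delta_sum (x : 'cV_p) : x = \sum_r delta (tnth b r) *~ x r 0.
  apply/colP=> r; rewrite summxE (bigD1 r) //= big1 => [|r' ne_r].
    by rewrite -scaler_int !mxE eqxx mulr1 intz addr0.
  rewrite -scaler_int !mxE (inj_eq (tuple_uniqP _ b_uniq)) eq_sym (negbTE ne_r).
  exact: mulr0.
exists a; split.
- split=> // y u lt_yn le_un.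
  have /tnthP[j wE] : W y u \in w by rewrite w_mem white_cell_in.
  have := column_sum (h := coker_pi M \o delta) tauP a_ge _ lt_yn le_un
    (esym wE).
  have -> : \sum_r (coker_pi M \o delta) (tnth b r) *~ M r j = 0.
    transitivity (coker_pi M (col j M)).
      rewrite [col j M]delta_sum raddf_sum; apply: eq_bigr => r _ /=.
      by rewrite raddfMz mxE.
    by rewrite colE coker_pi_im.
  move=> /(_ _)/esym rel0.
  rewrite -[LHS](mulrz_signK _ (eps y u)) rel0 ?mul0rz //.
  by move=> v i _; apply: deltaE.
- move=> P P0 PB Pa x.
  have PN y : P y -> P (- y) by rewrite -[- y]add0r; apply: PB.
  have PD y z : P y -> P z -> P (y + z).
    by move=> Py Pz; rewrite -[z]opprK; apply: PB => //; apply: PN.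
  have PM y m : P y -> P (y *~ m).
    move=> Py; have Pn q : P (y *+ q).
      by elim: q => [|q IH]; rewrite ?mulr0n ?mulrS //; apply: PD.
    by case: m => q; [apply: Pn | rewrite NegzE mulrNz; apply/PN/Pn].
  have [{}x ->] := coker_pi_surj x; rewrite [x]delta_sum raddf_sum.
  apply: big_ind => // r _.
  rewrite raddfMz /=; apply: (PM).
  have [v [i [le_vn lt_in ->]]] :=
    black_cellP (etrans (esym (b_mem _)) (mem_tnth r b)).
  by rewrite (deltaE v i) //; apply/PM/Pa.
move=> V a' [a'_ge a'_rel].
(* The inverse of [B]. *)
pose coord (s : cell) := let s' := flip e s in
  (`|(s'.1 + s'.2 + n%:Z + 1)%R|./2, `|(s'.2 - s'.1 + n%:Z - 1)%R|./2)%N.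
have coordK v i : (v <= n)%N -> (i < n)%N -> coord (B v i) = (v, i).
  move=> le_vn lt_in; rewrite /coord /B /black_cell flipK /=.
  by congr (_, _); lia.
pose h s := let: (v, i) := coord s in a' v i *~ (-1) ^+ tau v i.
have hB v i : (v <= n)%N -> (i < n)%N -> h (B v i) = a' v i *~ (-1) ^+ tau v i.
  by move=> le_vn lt_in; rewrite /h coordK.
have [j|f fE] := @coker_lift _ _ M _ (fun r => h (tnth b r)).
  have [y [u [lt_yn le_un wE]]] :=
    white_cellP (etrans (esym (w_mem _)) (mem_tnth j w)).
  rewrite (column_sum tauP a'_ge hB lt_yn le_un wE) a'_rel //.
  exact: mul0rz.
exists f => v i le_vn lt_in; rewrite /a lt_in raddfMz /= fE.
have /tnthP[r bE] : B v i \in b by rewrite b_mem black_cell_in.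
rewrite (bigD1 r) //= big1 => [|r' ne_r].
  by rewrite addr0 mxE -bE eqxx mulr1z hB // mulrz_signK.
by rewrite mxE bE (inj_eq (tuple_uniqP _ b_uniq)) (negbTE ne_r) mulr0z.
Qed.

End Presentation.

Theorem theorem16 (n p k : nat) (M : 'M[int]_(p, k)) :
  (1 <= n)%N ->
  kasteleyn_percus (aztec_diamond n) M ->
  zmod_isomorphic (coker M) (dirsum (fun i : 'I_n => 'Z_(2 ^ i.+1))).
Proof.
move=> _ [c [neg [b [w [Kneg [b_uniq b_mem] [_ w_mem] M_def]]]]].
apply: aztec_presented_iso.
exact: (coker_aztec_presented Kneg b_uniq b_mem w_mem M_def).
Qed.
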